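(* Let $\{y^k\}$ be generated by the safeguarded projected-gradient algorithm described in the context, from $y^0\in\mathcal C$. Suppose that: - there are constants $\underline\alpha,\overline\alpha$ with $0<\underline\alpha\le\alpha_k\le\overline\alpha<1/L$ for all $k$; - $\mathcal S\ne\varnothing$; - the level set $\mathcal L_0:=\{y\in\mathcal C:\Phi(y)\le\Phi(y^0)\}$ is bounded; - $\bigcup_{\alpha>0}\{y\in\mathcal C: y\in\Pi_{\mathcal C}(y-\alpha\nabla\Phi(y))\}\subseteq\mathcal S$; - $\alpha_k\in\mathcal A$ for all $k$, where $\mathcal A\subseteq[\underline\alpha,\overline\alpha]$ is finite and nonempty. Let $\kappa_r>0$ satisfy $\operatorname{dist}(y,\mathcal S)\le\kappa_r\|Hy-c\|$ for all $y\in\mathcal L_0$. Let $\kappa_G>0$ satisfy $\operatorname{dist}(y,\mathcal S)\le\kappa_G\,g_\alpha(y)$ for all $y\in\mathcal L_0$ and all $\alpha\in\mathcal A$, with $\kappa_G$ enlarged, if necessary, so that $$\eta:=\frac{2c_d\underline\alpha^2}{L\kappa_G^2}\in(0,1),\qquad \theta:=1-\eta\in(0,1).$$ Then, for all $k\ge0$, $$\Phi(y^k)\le\theta^k\,\Phi(y^0),\qquad \operatorname{dist}(y^k,\mathcal S)\le\kappa_r\sqrt{2\Phi(y^0)}\,\theta^{k/2}.$$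
   Context: Norms are Euclidean (vectors) and spectral (matrices); inequalities are componentwise and $\odot$ is the componentwise product. Let $P,Q\in\mathbb R^{m\times n}$, $c\in\mathbb R^m$, and $\mathcal C:=\{(u,v)\in\mathbb R^n\times\mathbb R^n: u\ge0,\ v\ge0,\ u\odot v=0\}$. For $y=(u,v)\in\mathbb R^{2n}$ set $H:=[P,\ Q]$, $\Phi(y):=\tfrac12\|Hy-c\|^2=\tfrac12\|Pu+Qv-c\|^2$, so $\nabla\Phi(y)=H^\top(Hy-c)$, and $L:=\|H\|^2$ (with $L>0$). Let $\mathcal S:=\{y\in\mathcal C: Hy=c\}$. For a nonempty closed set $\Omega$, $\Pi_\Omega(y):=\operatorname{argmin}_{z\in\Omega}\|y-z\|$ (possibly set-valued), and $\operatorname{dist}(y,\Omega):=\inf_{z\in\Omega}\|y-z\|$. For $\alpha>0$ and $y\in\mathcal C$, $\mathcal G_\alpha(y):=\{\alpha^{-1}(y-\widehat y):\widehat y\in\Pi_{\mathcal C}(y-\alpha\nabla\Phi(y))\}$ and $g_\alpha(y):=\operatorname{dist}(0,\mathcal G_\alpha(y))$. The descent constant is $c_d:=\frac1{2\overline\alpha}-\frac L2>0$. (Constants $\kappa_r$ and $\kappa_G$ with the required properties exist under the stated hypotheses.) Safeguarded projected-gradient algorithm. For $y=(u,v)\in\mathcal C$ let $\vartheta_i(y):=\operatorname{sgn}(u_i-v_i)\in\{-1,0,1\}$. Given $y^0\in\mathcal C$, an integer $q\ge1$, $\tau\ge0$, set $\nu_0=0$ and $s_c:=\max\{1,\|c\|\}$.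 At iteration $k=0,1,2,\dots$: choose a stepsize $\alpha_k>0$; choose $\bar y^{k+1}\in\Pi_{\mathcal C}(y^k-\alpha_k\nabla\Phi(y^k))$; set $\nu_{k+1}:=\nu_k+1$ if $\vartheta(\bar y^{k+1})=\vartheta(y^k)$ and $\nu_{k+1}:=0$ otherwise. The trigger $\mathcal T_k$ holds if and only if $\|H\bar y^{k+1}-c\|/s_c\le\tau$ or $\nu_{k+1}\ge q$. If $\mathcal T_k$ holds, a refinement candidate $\widehat y^{k+1}$ is computed by some rule (left open; the rule may fail to produce a candidate). If a candidate is produced and $\widehat y^{k+1}\in\mathcal C$ and $\Phi(\widehat y^{k+1})\le\Phi(\bar y^{k+1})$, set $y^{k+1}:=\widehat y^{k+1}$; in all other cases set $y^{k+1}:=\bar y^{k+1}$. *)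

(* Defs.v *)
From mathcomp Require Import all_boot all_order all_algebra.
From mathcomp Require Import all_classical all_reals all_analysis.
From mathcomp Require Import ring.

Set Implicit Arguments.
Unset Strict Implicit.
Unset Printing Implicit Defensive.

Import Order.TTheory GRing.Theory Num.Theory.
Import numFieldNormedType.Exports.

Local Open Scope classical_set_scope.
Local Open Scope ring_scope.

(* The norm that the library puts on matrices is the max norm, hence the
   Euclidean norm, and the distance and projection that it induces, below. *)
Definition enorm (R : realType) (p : nat) (x : 'cV[R]_p) : R :=
  Num.sqrt (\sum_i x i 0 ^+ 2).

(* Supremum over the unit ball, not the unit sphere: nonempty even if p = 0. *)
Definition specnorm (R : realType) (m p : nat) (A : 'M[R]_(m, p)) : R :=
  sup [set enorm (A *m x) | x in [set x | enorm x <= 1]].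

(* The real inf takes the junk value 0 on the empty set, so Omega is meant to be
   nonempty. *)
Definition dist (R : realType) (p : nat) (y : 'cV[R]_p) (Omega : set 'cV[R]_p)
    : R :=
  inf [set enorm (y - z) | z in Omega].

Definition proj (R : realType) (p : nat) (Omega : set 'cV[R]_p) (y : 'cV[R]_p)
    : set 'cV[R]_p :=
  [set z | Omega z /\ forall w, Omega w -> enorm (y - z) <= enorm (y - w)].

(* The partial derivative 'D_v f y is meaningful only if it exists; for Phi this
   is is_derive_Phi below. *)
Definition gradient (R : realType) (p : nat) (f : 'cV[R]_p -> R)
    (y : 'cV[R]_p) : 'cV[R]_p :=
  \col_i ('D_(delta_mx i 0) f y).

(* A point y = (u, v) is the stacked column col_mx u v. *)
Definition compl_set (R : realType) (n : nat) : set 'cV[R]_(n + n) :=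
  [set y | forall i, [/\ 0 <= usubmx y i 0, 0 <= dsubmx y i 0
                       & usubmx y i 0 * dsubmx y i 0 = 0]].
Arguments compl_set : clear implicits.

Definition Phi (R : realType) (m n : nat) (P Q : 'M[R]_(m, n)) (c : 'cV[R]_m)
    (y : 'cV[R]_(n + n)) : R :=
  2^-1 * enorm (row_mx P Q *m y - c) ^+ 2.

Lemma is_derive_Phi (R : realType) (m n : nat) (P Q : 'M[R]_(m, n))
    (c : 'cV[R]_m) (y e : 'cV[R]_(n + n)) :
  is_derive y e (Phi P Q c)
    (\sum_j (row_mx P Q *m e) j 0 * (row_mx P Q *m y - c) j 0).
Proof.
set H := row_mx P Q; set r := H *m y - c; set a := \sum_j _.
pose b := 2^-1 * \sum_j (H *m e) j 0 ^+ 2.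
have PhiE h : Phi P Q c (h *: e + y) = Phi P Q c y + h * a + h ^+ 2 * b.
  rewrite /Phi -/H /enorm !sqr_sqrtr; try by apply: sumr_ge0 => j _; exact: sqr_ge0.
  rewrite mulmxDr -scalemxAr -addrA -/r /a /b !mulr_sumr -!big_split /=.
  by apply: eq_bigr => j _; rewrite !mxE; field.
have cvga : (h^-1 *: (Phi P Q c (h *: e + y) - Phi P Q c y)) @[h --> 0^'] --> a.
  apply: (@cvg_trans _ ((a + h * b) @[h --> 0^'])).
    apply: near_eq_cvg; near=> h.
    have h0 : h != 0 by near: h; exact: nbhs_dnbhs_neq.
    by rewrite PhiE /GRing.scale /=; field.
  have : (a + h * b) @[h --> (0 : R)] --> a + 0 * b.
    by apply: cvgD; [exact: cvg_cst | apply: cvgM; [exact: cvg_id | exact: cvg_cst]].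
  by rewrite mul0r addr0; exact: cvg_within_filter.
split; last exact: cvg_lim.
by apply/cvg_ex; exists a.
Unshelve. all: by end_near. Qed.

Lemma gradient_Phi (R : realType) (m n : nat) (P Q : 'M[R]_(m, n))
    (c : 'cV[R]_m) (y : 'cV[R]_(n + n)) :
  gradient (Phi P Q c) y = (row_mx P Q)^T *m (row_mx P Q *m y - c).
Proof.
apply/colP => i; rewrite mxE.
have D := is_derive_Phi P Q c y (delta_mx i 0); rewrite derive_val.
rewrite [RHS]mxE; apply: eq_bigr => j _.
by rewrite -colE !mxE.
Qed.

Definition sol_set (R : realType) (m n : nat) (P Q : 'M[R]_(m, n))
    (c : 'cV[R]_m) : set 'cV[R]_(n + n) :=
  [set y | compl_set R n y /\ row_mx P Q *m y = c].

Definition level_set (R : realType) (m n : nat) (P Q : 'M[R]_(m, n))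
    (c : 'cV[R]_m) (y0 : 'cV[R]_(n + n)) : set 'cV[R]_(n + n) :=
  [set y | compl_set R n y /\ Phi P Q c y <= Phi P Q c y0].

Definition Lconst (R : realType) (m n : nat) (P Q : 'M[R]_(m, n)) : R :=
  specnorm (row_mx P Q) ^+ 2.

Definition pg_step (R : realType) (m n : nat) (P Q : 'M[R]_(m, n))
    (c : 'cV[R]_m) (alpha : R) (y : 'cV[R]_(n + n)) : set 'cV[R]_(n + n) :=
  proj (compl_set R n) (y - alpha *: gradient (Phi P Q c) y).

Definition fixed_points (R : realType) (m n : nat) (P Q : 'M[R]_(m, n))
    (c : 'cV[R]_m) (alpha : R) : set 'cV[R]_(n + n) :=
  [set y | compl_set R n y /\ pg_step P Q c alpha y y].

Definition grad_map (R : realType) (m n : nat) (P Q : 'M[R]_(m, n))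
    (c : 'cV[R]_m) (alpha : R) (y : 'cV[R]_(n + n)) : set 'cV[R]_(n + n) :=
  [set alpha^-1 *: (y - yhat) | yhat in pg_step P Q c alpha y].

(* grad_map is nonempty: compl_set is closed and contains 0. *)
Definition grad_residual (R : realType) (m n : nat) (P Q : 'M[R]_(m, n))
    (c : 'cV[R]_m) (alpha : R) (y : 'cV[R]_(n + n)) : R :=
  dist 0 (grad_map P Q c alpha y).

Definition sign_pattern (R : realType) (n : nat) (y : 'cV[R]_(n + n))
    : 'cV[R]_n :=
  \col_i Num.sg (usubmx y i 0 - dsubmx y i 0).

Definition trigger (R : realType) (m n : nat) (P Q : 'M[R]_(m, n))
    (c : 'cV[R]_m) (q : nat) (tau : R) (ybar : 'cV[R]_(n + n)) (nu : nat)
    : Prop :=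
  enorm (row_mx P Q *m ybar - c) / Num.max 1 (enorm c) <= tau \/ (q <= nu)%N.

Definition safeguard (R : realType) (m n : nat) (P Q : 'M[R]_(m, n))
    (c : 'cV[R]_m) (T : Prop) (cand : option 'cV[R]_(n + n))
    (ybar : 'cV[R]_(n + n)) : 'cV[R]_(n + n) :=
  if `[< T >] then
    if cand is Some yhat then
      if `[< compl_set R n yhat /\ Phi P Q c yhat <= Phi P Q c ybar >]
      then yhat else ybar
    else ybar
  else ybar.

(* A run of the algorithm. The refinement rule is left open: cand k.+1 is what
   it returns at iteration k, None meaning that it fails, and it is only looked
   at when the trigger holds. The values ybar 0 and cand 0 play no role. *)
Record safeguarded_pg_run (R : realType) (m n : nat) (P Q : 'M[R]_(m, n))
    (c : 'cV[R]_m) (q : nat) (tau : R) (y0 : 'cV[R]_(n + n))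
    (alpha : nat -> R) (y ybar : nat -> 'cV[R]_(n + n)) (nu : nat -> nat)
    (cand : nat -> option 'cV[R]_(n + n)) : Prop := SafeguardedPgRun {
  run_y0C : compl_set R n y0 ;
  run_q : (1 <= q)%N ;
  run_tau : 0 <= tau ;
  run_y0 : y 0%N = y0 ;
  run_nu0 : nu 0%N = 0%N ;
  run_alpha : forall k, 0 < alpha k ;
  run_ybar : forall k, pg_step P Q c (alpha k) (y k) (ybar k.+1) ;
  run_nu : forall k,
    nu k.+1 = if sign_pattern (ybar k.+1) == sign_pattern (y k)
              then (nu k).+1 else 0%N ;
  run_y : forall k,
    y k.+1 = safeguard P Q c (trigger P Q c q tau (ybar k.+1) (nu k.+1))
                       (cand k.+1) (ybar k.+1)
}.

Definition descent_const (R : realType) (L alphamax : R) : R :=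
  (2 * alphamax)^-1 - L / 2.

(* Main.v *)
Require Import Defs.
From mathcomp Require Import all_boot all_order all_algebra.
From mathcomp Require Import all_classical all_reals all_analysis.
From mathcomp Require Import ring lra.
Import Order.TTheory GRing.Theory Num.Theory.
Import numFieldNormedType.Exports.
Local Open Scope classical_set_scope.
Local Open Scope ring_scope.

(** The linear rate is the product of three inequalities valid at every point
    [z] of the level set, for a step [zbar] of size [a] from [z].

    - Sufficient decrease ([pg_step_descent]).  The point [z] itself belongs to
      the complementarity set, so it competes in the projection defining
      [zbar]; this comparison alone gives
      [<grad Phi z, zbar - z> <= - |zbar - z|^2 / (2 a)], with no convexity of
      the constraint set.  As [Phi] is quadratic with curvature at most [L],
      the objective drops by at least [c_d |zbar - z|^2].
    - Error bound ([dist_le_pg_step]).  The displacement [|zbar - z| / a]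
      dominates the residual [g_a z], and hence [dist z S / kappaG].
    - Quadratic growth from above ([Phi_le_dist]).  Since [H z - c = H (z - s)]
      for every solution [s], one has [Phi z <= L / 2 * dist z S ^ 2].

    Chained together, they say that a projected gradient step removes at least
    the fraction [eta] of [Phi z] ([pg_step_contraction]).  The safeguard
    accepts a refinement only if it is feasible and does not increase [Phi], so
    the contraction survives whatever the refinement rule does, and the
    iterates never leave the level set on which the error bounds hold.  The
    estimate on the distance is then the residual error bound
    [dist <= kappar |H y - c| = kappar sqrt (2 Phi y)]. *)

(** * Euclidean and spectral norms *)

Definition dot {R : realType} {p : nat} (x y : 'cV[R]_p) : R :=
  \sum_i x i 0 * y i 0.

Lemma enorm_ge0 {R : realType} {p : nat} (x : 'cV[R]_p) : 0 <= enorm x.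
Proof. exact: sqrtr_ge0. Qed.

Lemma enorm_sqr {R : realType} {p : nat} (x : 'cV[R]_p) :
  enorm x ^+ 2 = \sum_i x i 0 ^+ 2.
Proof. by rewrite sqr_sqrtr// sumr_ge0// => i _; exact: sqr_ge0. Qed.

Lemma enormZ {R : realType} {p : nat} (a : R) (x : 'cV[R]_p) :
  enorm (a *: x) = `|a| * enorm x.
Proof.
rewrite /enorm -sqrtr_sqr -sqrtrM ?sqr_ge0//; congr Num.sqrt.
by rewrite mulr_sumr; apply: eq_bigr => i _; rewrite !mxE exprMn.
Qed.

Lemma enormN {R : realType} {p : nat} (x : 'cV[R]_p) : enorm (- x) = enorm x.
Proof. by rewrite -scaleN1r enormZ normrN1 mul1r. Qed.

Lemma enorm_sqrD {R : realType} {p : nat} (x y : 'cV[R]_p) :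
  enorm (x + y) ^+ 2 = enorm x ^+ 2 + 2 * dot x y + enorm y ^+ 2.
Proof.
rewrite !enorm_sqr /dot mulr_sumr -!big_split /=.
by apply: eq_bigr => i _; rewrite !mxE; ring.
Qed.

Lemma dotZl {R : realType} {p : nat} (a : R) (x y : 'cV[R]_p) :
  dot (a *: x) y = a * dot x y.
Proof.
by rewrite /dot mulr_sumr; apply: eq_bigr => i _; rewrite mxE mulrA.
Qed.

Lemma dot_trmx_mul {R : realType} {m p : nat} (A : 'M[R]_(m, p))
    (r : 'cV[R]_m) (d : 'cV[R]_p) :
  dot (A^T *m r) d = dot r (A *m d).
Proof.
have dotE k (u v : 'cV[R]_k) : dot u v = (u^T *m v) 0 0.
  by rewrite mxE; apply: eq_bigr => i _; rewrite mxE.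
by rewrite !dotE trmx_mul trmxK mulmxA.
Qed.

Lemma coord_le_enorm {R : realType} {p : nat} (x : 'cV[R]_p) (i : 'I_p) :
  `|x i 0| <= enorm x.
Proof.
rewrite -sqrtr_sqr ler_wsqrtr// (bigD1 i)//= lerDl.
by rewrite sumr_ge0// => j _; exact: sqr_ge0.
Qed.

Lemma enorm_eq0 {R : realType} {p : nat} (x : 'cV[R]_p) :
  enorm x = 0 -> x = 0.
Proof.
move=> x0; apply/colP => i; rewrite mxE.
by apply/eqP; rewrite -normr_le0 -x0 coord_le_enorm.
Qed.

(** The supremum of reals defaults to [0] on unbounded sets, so the spectral
    norm has its meaning only once this bound is known; the sum of the absolute
    row sums is a crude bound that avoids the Cauchy-Schwarz inequality. *)
Lemma specnorm_set_bounded {R : realType} {m p : nat} (A : 'M[R]_(m, p)) :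
  has_ubound [set enorm (A *m x) | x in [set x | enorm x <= 1]].
Proof.
exists (Num.sqrt (\sum_i (\sum_j `|A i j|) ^+ 2)) => _ [x /= x1 <-].
rewrite ler_wsqrtr//; apply: ler_sum => i _.
rewrite -real_normK ?num_real// lerXn2r ?nnegrE ?sumr_ge0//.
rewrite mxE (le_trans (ler_norm_sum _ _ _))//; apply: ler_sum => j _.
by rewrite normrM ler_piMr// (le_trans (coord_le_enorm _ _)).
Qed.

Lemma enorm_mulmx_le {R : realType} {m p : nat} (A : 'M[R]_(m, p))
    (x : 'cV[R]_p) : enorm (A *m x) <= specnorm A * enorm x.
Proof.
have [/enorm_eq0 ->|x0] := eqVneq (enorm x) 0.
  by rewrite mulmx0 -(scale0r (0 : 'cV[R]_m)) -(scale0r (0 : 'cV[R]_p))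
             !enormZ normr0 !mul0r mulr0.
have xgt0 : 0 < enorm x by rewrite lt_neqAle eq_sym x0 enorm_ge0.
have nV : `|(enorm x)^-1| = (enorm x)^-1 by rewrite ger0_norm// invr_ge0 ltW.
rewrite -ler_pdivrMr// mulrC -{1}nV -enormZ scalemxAr.
apply: ub_le_sup; first exact: specnorm_set_bounded.
by exists ((enorm x)^-1 *: x) => //=; rewrite enormZ nV mulVf.
Qed.

(** * Distance to a set *)

Lemma dist_le_enorm {R : realType} {p : nat} {y z : 'cV[R]_p}
    {Omega : set 'cV[R]_p} : Omega z -> dist y Omega <= enorm (y - z).
Proof.
move=> Oz; apply: ge_inf; last by exists z.
by exists 0 => _ [w _ <-]; exact: enorm_ge0.
Qed.

Lemma le_dist {R : realType} {p : nat} {y : 'cV[R]_p} {Omega : set 'cV[R]_p}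
    (t : R) : Omega !=set0 -> (forall z, Omega z -> t <= enorm (y - z)) ->
  t <= dist y Omega.
Proof.
move=> [z Oz] le_t; apply: lb_le_inf; first by exists (enorm (y - z)), z.
by move=> _ [w Ow <-]; exact: le_t.
Qed.

(** * One projected gradient step *)

Section OneStep.
Context {R : realType} {m n : nat} (P Q : 'M[R]_(m, n)) (c : 'cV[R]_m).

Let H := row_mx P Q.
Let L := Lconst P Q.

Lemma Phi_ge0 (z : 'cV[R]_(n + n)) : 0 <= Phi P Q c z.
Proof. by rewrite mulr_ge0 ?invr_ge0// sqr_ge0. Qed.

Lemma enorm_residual (z : 'cV[R]_(n + n)) :
  enorm (H *m z - c) = Num.sqrt (2 * Phi P Q c z).
Proof. by rewrite mulrA divff// mul1r sqrtr_sqr ger0_norm// enorm_ge0. Qed.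

Lemma Phi_expansion (z d : 'cV[R]_(n + n)) :
  Phi P Q c (z + d) =
  Phi P Q c z + dot (gradient (Phi P Q c) z) d + 2^-1 * enorm (H *m d) ^+ 2.
Proof.
rewrite gradient_Phi dot_trmx_mul /Phi -/H mulmxDr addrAC enorm_sqrD.
by field.
Qed.

Lemma enorm_mulH_sqr_le (d : 'cV[R]_(n + n)) :
  enorm (H *m d) ^+ 2 <= L * enorm d ^+ 2.
Proof.
rewrite -exprMn lerXn2r ?nnegrE ?enorm_ge0 ?enorm_mulmx_le//.
exact: le_trans (enorm_ge0 _) (enorm_mulmx_le _ _).
Qed.

(** Optimality of the projection is used only against the competitor [z], which
    costs a factor 2 with respect to a convex constraint set: the first-order
    term is at most [- |zbar - z|^2 / (2 a)], and the curvature term [L / 2]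
    has to be absorbed by it, hence the restriction [a < 1 / L] later on. *)
Lemma pg_step_descent (a : R) (z zbar : 'cV[R]_(n + n)) :
  0 < a -> compl_set R n z -> pg_step P Q c a z zbar ->
  Phi P Q c zbar <= Phi P Q c z - descent_const L a * enorm (z - zbar) ^+ 2.
Proof.
move=> a0 Cz [_ /(_ _ Cz)]; set g := gradient _ _; set d := zbar - z.
(* [z] competes with [zbar] in the projection of [z - a g] *)
have -> : z - a *: g - zbar = - (a *: g + d).
  by rewrite /d opprD opprB addrCA addrA.
have -> : z - a *: g - z = - (a *: g) by rewrite addrAC subrr add0r.
rewrite !enormN => le_proj.
have : enorm (a *: g + d) ^+ 2 <= enorm (a *: g) ^+ 2.
  by rewrite lerXn2r// nnegrE enorm_ge0.
rewrite (enorm_sqrD (a *: g)) dotZl => le_gd.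
have -> : enorm (z - zbar) = enorm d by rewrite -enormN opprB.
have -> : zbar = z + d by rewrite /d addrC subrK.
rewrite Phi_expansion -/g.
have le_g : dot g d <= - ((2 * a)^-1 * enorm d ^+ 2).
  have a20 : 0 < 2 * a by rewrite mulr_gt0.
  rewrite -(ler_pM2l a20) mulrN mulVKf ?gt_eqF//; lra.
have := enorm_mulH_sqr_le d; rewrite /descent_const; lra.
Qed.

Lemma dist_le_pg_step (Omega : set 'cV[R]_(n + n)) (kappa a : R)
    (z zbar : 'cV[R]_(n + n)) :
  0 < a -> 0 <= kappa -> dist z Omega <= kappa * grad_residual P Q c a z ->
  pg_step P Q c a z zbar ->
  a * dist z Omega <= kappa * enorm (z - zbar).
Proof.
move=> a0 kappa0 le_res step.
have le_g : grad_residual P Q c a z <= a^-1 * enorm (z - zbar).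
  apply: (@le_trans _ _ (enorm (0 - a^-1 *: (z - zbar)))).
    by apply: dist_le_enorm; exists zbar.
  by rewrite sub0r enormN enormZ ger0_norm// invr_ge0 ltW.
rewrite -ler_pdivlMl//; apply: (le_trans le_res).
by rewrite mulrCA ler_wpM2l.
Qed.

(** The infimum defining [dist] need not be attained for this argument: every
    solution [s] gives the bound [sqrt (2 Phi z / L) <= |z - s|], so it passes
    to the infimum; hence the proof works with square roots. *)
Lemma Phi_le_dist (z : 'cV[R]_(n + n)) :
  0 < L -> sol_set P Q c !=set0 ->
  2 * Phi P Q c z <= L * dist z (sol_set P Q c) ^+ 2.
Proof.
move=> L0 S0.
have dist0 : 0 <= dist z (sol_set P Q c).
  by apply: le_dist => // s _; exact: enorm_ge0.
have Phi2 : 0 <= 2 * Phi P Q c z / L.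
  by apply: divr_ge0; [exact: mulr_ge0 (ler0n _ 2) (Phi_ge0 z) | exact: ltW].
rewrite -ler_pdivrMl// mulrC -(sqr_sqrtr Phi2).
rewrite lerXn2r ?nnegrE ?sqrtr_ge0//.
apply: le_dist => // s [_ Hs].
rewrite -(ger0_norm (enorm_ge0 (z - s))) -sqrtr_sqr ler_wsqrtr//.
rewrite ler_pdivrMr// [leRHS]mulrC mulrA divff// mul1r -Hs -mulmxBr.
exact: enorm_mulH_sqr_le.
Qed.

Lemma descent_const_anti (a b : R) :
  0 < a -> a <= b -> descent_const L b <= descent_const L a.
Proof.
move=> a0 ab; rewrite lerD2r lef_pV2 ?posrE ?mulr_gt0//; last exact: lt_le_trans ab.
by rewrite ler_pM2l.
Qed.

Lemma descent_const_ge0 (b : R) :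
  0 < L -> 0 < b -> b < 1 / L -> 0 <= descent_const L b.
Proof.
move=> L0 b0 bL; rewrite /descent_const subr_ge0 invfM mulrC ler_pM2l ?invr_gt0//.
by rewrite -(invrK L) lef_pV2 ?posrE ?invr_gt0// -div1r ltW.
Qed.

(** The stepsize enters twice, and monotonically each time, hence the two ends
    of the stepsize range in the rate. *)
Lemma pg_step_contraction (amin a amax kappa : R) (z zbar : 'cV[R]_(n + n)) :
  0 < L -> 0 < amin -> amin <= a <= amax -> amax < 1 / L -> 0 < kappa ->
  sol_set P Q c !=set0 -> compl_set R n z ->
  dist z (sol_set P Q c) <= kappa * grad_residual P Q c a z ->
  pg_step P Q c a z zbar ->
  Phi P Q c zbar <=
    (1 - 2 * descent_const L amax * amin ^+ 2 / (L * kappa ^+ 2)) * Phi P Q c z.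
Proof.
move=> L0 amin0 /andP[le_a le_amax] amaxL kappa0 S0 Cz le_res step.
have a0 : 0 < a := lt_le_trans amin0 le_a.
set cd := descent_const L amax.
have cd0 : 0 <= cd by rewrite descent_const_ge0// (lt_le_trans a0).
have dist0 : 0 <= dist z (sol_set P Q c).
  by apply: le_dist => // s _; exact: enorm_ge0.
have le_d : (amin * dist z (sol_set P Q c)) ^+ 2 <=
            (kappa * enorm (z - zbar)) ^+ 2.
  rewrite lerXn2r ?nnegrE ?mulr_ge0 ?enorm_ge0 ?(ltW amin0) ?(ltW kappa0)//.
  apply: le_trans (dist_le_pg_step _ _ _ _ _ a0 (ltW kappa0) le_res step).
  by rewrite ler_wpM2r.
have Lk0 : 0 < L * kappa ^+ 2 by rewrite mulr_gt0// exprn_gt0.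
have le_Phi : amin ^+ 2 * (2 * Phi P Q c z) <=
              L * kappa ^+ 2 * enorm (z - zbar) ^+ 2.
  apply: (@le_trans _ _ (amin ^+ 2 * (L * dist z (sol_set P Q c) ^+ 2))).
    by rewrite ler_wpM2l ?sqr_ge0// Phi_le_dist.
  by move: le_d; rewrite mulrCA -(mulrA L) (ler_pM2l L0) !exprMn.
have le_eta : 2 * cd * amin ^+ 2 / (L * kappa ^+ 2) * Phi P Q c z <=
              cd * enorm (z - zbar) ^+ 2.
  have -> : 2 * cd * amin ^+ 2 / (L * kappa ^+ 2) * Phi P Q c z =
            cd * ((L * kappa ^+ 2)^-1 * (amin ^+ 2 * (2 * Phi P Q c z))).
    by ring.
  by rewrite ler_wpM2l// ler_pdivrMl.
have le_cd : cd * enorm (z - zbar) ^+ 2 <=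
             descent_const L a * enorm (z - zbar) ^+ 2.
  by rewrite ler_wpM2r ?sqr_ge0// descent_const_anti.
apply: (le_trans (pg_step_descent _ _ _ a0 Cz step)).
rewrite [leRHS]mulrBl mul1r lerD2l lerN2; exact: le_trans le_cd.
Qed.

Lemma safeguard_le (T : Prop) (cand : option 'cV[R]_(n + n))
    (zbar : 'cV[R]_(n + n)) :
  compl_set R n zbar ->
  compl_set R n (safeguard P Q c T cand zbar) /\
  Phi P Q c (safeguard P Q c T cand zbar) <= Phi P Q c zbar.
Proof.
move=> Cz; rewrite /safeguard; case: ifP => // _; case: cand => // w.
by case: ifP => // /asboolP.
Qed.

End OneStep.

(** * Linear convergence *)

Theorem theorem5 (R : realType) (m n : nat) (P Q : 'M[R]_(m, n))
    (c : 'cV[R]_m) (q : nat) (tau : R) (y0 : 'cV[R]_(n + n))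
    (alpha : nat -> R) (y ybar : nat -> 'cV[R]_(n + n)) (nu : nat -> nat)
    (cand : nat -> option 'cV[R]_(n + n))
    (alphamin alphamax : R) (A : set R) (kappar kappaG : R)
    (L_gt0 : 0 < Lconst P Q)
    (run : safeguarded_pg_run P Q c q tau y0 alpha y ybar nu cand)
    (alphamin_gt0 : 0 < alphamin)
    (alpha_bounds : forall k, alphamin <= alpha k <= alphamax)
    (alphamax_lt : alphamax < 1 / Lconst P Q)
    (S_neq0 : sol_set P Q c !=set0)
    (level_bounded :
      exists M, forall z, level_set P Q c y0 z -> enorm z <= M)
    (fixed_sub :
      \bigcup_(a in [set a | 0 < a]) fixed_points P Q c a `<=` sol_set P Q c)
    (A_finite : finite_set A)
    (A_neq0 : A !=set0)
    (A_sub : A `<=` [set a | alphamin <= a <= alphamax])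
    (alpha_A : forall k, A (alpha k))
    (kappar_gt0 : 0 < kappar)
    (kappar_bound : forall z, level_set P Q c y0 z ->
      dist z (sol_set P Q c) <= kappar * enorm (row_mx P Q *m z - c))
    (kappaG_gt0 : 0 < kappaG)
    (kappaG_bound : forall z a, level_set P Q c y0 z -> A a ->
      dist z (sol_set P Q c) <= kappaG * grad_residual P Q c a z) :
  let L := Lconst P Q in
  let eta := 2 * descent_const L alphamax * alphamin ^+ 2 / (L * kappaG ^+ 2) in
  let theta := 1 - eta in
  0 < eta < 1 ->
  0 < theta < 1 ->
  forall k : nat,
    Phi P Q c (y k) <= theta ^+ k * Phi P Q c y0 /\
    dist (y k) (sol_set P Q c)
      <= kappar * Num.sqrt (2 * Phi P Q c y0) * theta `^ (k%:R / 2).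
Proof.
move=> L eta theta _ /andP[theta0 theta1] k.
have level j : compl_set R n (y j) ->
    Phi P Q c (y j) <= theta ^+ j * Phi P Q c y0 ->
    level_set P Q c y0 (y j).
  move=> Cy /le_trans le_Phi; split=> //; apply: le_Phi.
  by rewrite ler_piMl ?Phi_ge0// exprn_ile1// ltW.
have decay j : compl_set R n (y j) /\
    Phi P Q c (y j) <= theta ^+ j * Phi P Q c y0.
  elim: j => [|j [Cy IH]].
    by rewrite (run_y0 run) expr0 mul1r; split => //; exact: run_y0C run.
  have Ly := level j Cy IH.
  have step := run_ybar run j.
  have [Cnext le_next] := safeguard_le P Q c
    (trigger P Q c q tau (ybar j.+1) (nu j.+1)) (cand j.+1) _ (proj1 step).
  rewrite (run_y run); split=> //; apply: (le_trans le_next).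
  have contr := pg_step_contraction P Q c _ _ _ _ _ _ L_gt0 alphamin_gt0
    (alpha_bounds j) alphamax_lt kappaG_gt0 S_neq0 Cy
    (kappaG_bound _ _ Ly (alpha_A j)) step.
  apply: (le_trans contr); rewrite [theta ^+ _]exprS -[leRHS]mulrA.
  exact: (ler_wpM2l (ltW theta0)) IH.
have [Cy le_Phi] := decay k; split=> //.
apply: (le_trans (kappar_bound _ (level k Cy le_Phi))).
rewrite -mulrA ler_pM2l// enorm_residual.
have -> : theta `^ (k%:R / 2) = Num.sqrt (theta ^+ k).
  by rewrite powRrM powR_mulrn ?(ltW theta0)// powR12_sqrt// exprn_ge0// ltW.
rewrite -sqrtrM; last exact: mulr_ge0 (ler0n _ 2) (Phi_ge0 _ _ _ _).
by apply: ler_wsqrtr; rewrite -[leRHS]mulrA ler_pM2l// [leRHS]mulrC.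
Qed.
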